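(* For any epistemic theory $\Gamma$, every equilibrium world view of $\Gamma$ is also a G91-world view of $\Gamma$.
   Context: Fix a set $\mathrm{At}$ of atoms. Formulas: $\varphi ::= \bot \mid a \mid \varphi_1\wedge\varphi_2 \mid \varphi_1\vee\varphi_2\mid \varphi_1\to\varphi_2 \mid \mathbf{L}\varphi$; $\neg\varphi := \varphi\to\bot$, $\top:=\neg\bot$. A theory is a set of formulas. G91. A belief view $\mathcal W$ is a set of interpretations $I\subseteq\mathrm{At}$. $\langle\mathcal W,I\rangle\models\varphi$ is classical on $\bot,\wedge,\vee,\to$, with $\langle\mathcal W,I\rangle\models a$ iff $a\in I$ and $\langle\mathcal W,I\rangle\models\mathbf L\psi$ iff $\langle\mathcal W,J\rangle\models\psi$ for all $J\in\mathcal W$ (write $\mathcal W\models\mathbf L\psi$). The subjective reduct $\Gamma^{\mathcal W}$ replaces each maximal subformula $\mathbf L\psi$ by $\top$ if $\mathcal W\models\mathbf L\psi$, else by $\bot$. For $\mathbf L$-free formulas, HT satisfaction on pairs $\langle H,T\rangle$, $H\subseteq T$: $\not\models\bot$; $\models p$ iff $p\in H$; $\wedge,\vee$ componentwise; $\models\varphi\to\psi$ iff $T\models\varphi\to\psi$ classically and ($\not\models\varphi$ or $\models\psi$). $T$ is a stable model of $\Gamma$ iff $T\models\Gamma$ classically and no $H\subsetneq T$ has $\langle H,T\rangle\models\Gamma$; $\mathrm{SM}[\Gamma]$ is the set of stable models. $\mathcal W$ is a G91-world view of $\Gamma$ iff $\mathcal W=\mathrm{SM}[\Gamma^{\mathcal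 W}]$. FAEEL. HT belief views are non-empty sets $\mathcal W$ of pairs $\langle H_i,T_i\rangle$, $H_i\subseteq T_i\subseteq\mathrm{At}$; $\mathcal W^t=\{T_i\}$; total if all $H_i=T_i$ (identified with a set of interpretations). For $\mathcal I=\langle\mathcal W,H,T\rangle$ with $H\subseteq T$: $\mathcal I\not\models\bot$; $\mathcal I\models a$ iff $a\in H$; $\wedge,\vee$ componentwise; $\mathcal I\models\psi_1\to\psi_2$ iff ($\mathcal I\not\models\psi_1$ or $\mathcal I\models\psi_2$) and ($\langle\mathcal W^t,T,T\rangle\not\models\psi_1$ or $\langle\mathcal W^t,T,T\rangle\models\psi_2$); $\mathcal I\models\mathbf L\psi$ iff $\langle\mathcal W,H_i,T_i\rangle\models\psi$ for all $\langle H_i,T_i\rangle\in\mathcal W$. Belief model of $\Gamma$: $\langle\mathcal W,H_i,T_i\rangle\models\varphi$ for all $\varphi\in\Gamma$ and all $\langle H_i,T_i\rangle\in\mathcal W\cup\{\langle H,T\rangle\}$. $\langle\mathcal W',H',T'\rangle\preceq\langle\mathcal W,H,T\rangle$ iff $T'=T$, $H'\subseteq H$, every $\langle H_i,T_i\rangle\in\mathcal W$ has some $\langle H'_i,T_i\rangle\in\mathcal W'$ with $H'_i\subseteq H_i$, and every $\langle H'_i,T_i\rangle\in\mathcal W'$ has some $\langle H_i,T_i\rangle\in\mathcal W$ with $H'_i\subseteq H_i$; $\prec$ strict. A total $\langle\mathcal W,T,T\rangle$ is an equilibrium belief model of $\Gamma$ if it is a belief model and no belief model is $\prec$ it; $\mathrm{EQB}[\Gamma]$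 their set. A total belief view $\mathcal W$ is an equilibrium world view of $\Gamma$ iff $\mathcal W=\{T:\langle\mathcal W,T,T\rangle\in\mathrm{EQB}[\Gamma]\}$. *)

(* Defs.v *)
From mathcomp Require Import all_boot.
From mathcomp Require Import boolp classical_sets.

Set Implicit Arguments.
Unset Strict Implicit.
Unset Printing Implicit Defensive.

Local Open Scope classical_set_scope.

Section Epistemic.

Variable At : Type.

Inductive formula : Type :=
| Bot
| Atom of At
| And of formula & formula
| Or of formula & formula
| Imp of formula & formula
| L of formula.

Definition theory := set formula.

(* The L-free formulas; they have their own type so that classical and HT
   satisfaction need no value on L. *)
Inductive oformula : Type :=
| OBot
| OAtom of At
| OAnd of oformula & oformula
| OOr of oformula & oformula
| OImp of oformula & oformula.

Definition OTop : oformula := OImp OBot OBot.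

Definition otheory := set oformula.

Definition interp := set At.

Fixpoint g91_sat (W : set interp) (I : interp) (phi : formula) : Prop :=
  match phi with
  | Bot => False
  | Atom a => I a
  | And f g => g91_sat W I f /\ g91_sat W I g
  | Or f g => g91_sat W I f \/ g91_sat W I g
  | Imp f g => g91_sat W I f -> g91_sat W I g
  | L f => forall J, W J -> g91_sat W J f
  end.

Definition g91_believes (W : set interp) (psi : formula) : Prop :=
  forall J, W J -> g91_sat W J psi.

Fixpoint reduct (W : set interp) (phi : formula) : oformula :=
  match phi with
  | Bot => OBot
  | Atom a => OAtom a
  | And f g => OAnd (reduct W f) (reduct W g)
  | Or f g => OOr (reduct W f) (reduct W g)
  | Imp f g => OImp (reduct W f) (reduct W g)
  | L f => if `[< g91_believes W f >] then OTop else OBot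
  end.

Definition subjective_reduct (Gamma : theory) (W : set interp) : otheory :=
  [set reduct W phi | phi in Gamma].

Fixpoint classical_sat (T : interp) (phi : oformula) : Prop :=
  match phi with
  | OBot => False
  | OAtom a => T a
  | OAnd f g => classical_sat T f /\ classical_sat T g
  | OOr f g => classical_sat T f \/ classical_sat T g
  | OImp f g => classical_sat T f -> classical_sat T g
  end.

Fixpoint ht_sat (H T : interp) (phi : oformula) : Prop :=
  match phi with
  | OBot => False
  | OAtom a => H a
  | OAnd f g => ht_sat H T f /\ ht_sat H T g
  | OOr f g => ht_sat H T f \/ ht_sat H T g
  | OImp f g => classical_sat T (OImp f g) /\ (~ ht_sat H T f \/ ht_sat H T g)
  end.

Definition stable_models (Gamma : otheory) : set interp :=
  [set T | (forall phi, Gamma phi -> classical_sat T phi) /\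
           ~ exists H : interp, H `<` T /\
               forall phi, Gamma phi -> ht_sat H T phi].

Definition g91_world_view (Gamma : theory) (W : set interp) : Prop :=
  W = stable_models (subjective_reduct Gamma W).

(* A pair (H, T) stands for <H, T>; H `<=` T and non-emptiness of views are
   imposed by ht_belief_view and is_belief_interp. *)
Definition ht_view := set (interp * interp).

Definition ht_belief_view (W : ht_view) : Prop :=
  W !=set0 /\ forall p, W p -> p.1 `<=` p.2.

(* The identification of a set of interpretations with a total view. *)
Definition total_view (V : set interp) : ht_view := [set (T, T) | T in V].

Definition there_view (W : ht_view) : set interp := [set p.2 | p in W].

Fixpoint faeel_sat (phi : formula) (W : ht_view) (H T : interp) : Prop :=
  match phi with
  | Bot => False
  | Atom a => H a
  | And f g => faeel_sat f W H T /\ faeel_sat g W H T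
  | Or f g => faeel_sat f W H T \/ faeel_sat g W H T
  | Imp f g =>
      (~ faeel_sat f W H T \/ faeel_sat g W H T) /\
      (~ faeel_sat f (total_view (there_view W)) T T \/
       faeel_sat g (total_view (there_view W)) T T)
  | L f => forall p, W p -> faeel_sat f W p.1 p.2
  end.

Record belief_interp := BeliefInterp {
  view : ht_view;
  here : interp;
  there : interp }.

Definition is_belief_interp (I : belief_interp) : Prop :=
  ht_belief_view (view I) /\ here I `<=` there I.

Definition is_total (I : belief_interp) : Prop :=
  (forall p, view I p -> p.1 = p.2) /\ here I = there I.

Definition belief_model (Gamma : theory) (I : belief_interp) : Prop :=
  is_belief_interp I /\
  forall phi, Gamma phi ->
    forall p, (view I `|` [set (here I, there I)]) p ->
      faeel_sat phi (view I) p.1 p.2.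

Definition bi_le (I' I : belief_interp) : Prop :=
  [/\ there I' = there I,
      here I' `<=` here I,
      forall H T, view I (H, T) ->
        exists2 H', view I' (H', T) & H' `<=` H &
      forall H' T, view I' (H', T) ->
        exists2 H, view I (H, T) & H' `<=` H].

Definition bi_lt (I' I : belief_interp) : Prop := bi_le I' I /\ I' <> I.

Definition EQB (Gamma : theory) : set belief_interp :=
  [set I | [/\ is_total I, belief_model Gamma I &
               ~ exists I', belief_model Gamma I' /\ bi_lt I' I]].

Definition equilibrium_world_view (Gamma : theory) (W : set interp) : Prop :=
  ht_belief_view (total_view W) /\
  W = [set T | EQB Gamma (BeliefInterp (total_view W) T T)].

End Epistemic.

(* Main.v *)
(** On a total view [W], FAEEL satisfaction at [<H, T>] coincides with HT
    satisfaction of the subjective reduct with respect to [W].  Hence an [H]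
    refuting the stability of a world [T] of [W] also refutes minimality of
    [<W, T, T>], the view being kept fixed.  Conversely, let [T] be stable and
    consider a belief model below [<W, T, T>].  Each of its worlds can take over
    the role of the actual world, so its view must be [W], for otherwise it
    would refute minimality of [<W, T0, T0>] for any [T0] in [W]; with the view
    fixed, stability prevents its here component from shrinking. *)

Require Import Defs.
From mathcomp Require Import all_boot.
From mathcomp Require Import boolp classical_sets.

Set Implicit Arguments.
Unset Strict Implicit.
Unset Printing Implicit Defensive.

Local Open Scope classical_set_scope.

Section EquilibriumWorldViews.

Variable At : Type.
Implicit Types (f : formula At) (Gamma : theory At) (Delta : otheory At).
Implicit Types (W : set (interp At)) (V : ht_view At) (H T : interp At).

Definition classical_models Delta : set (interp At) :=
  [set T | Delta `<=` classical_sat T].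

Definition ht_model Delta H T : Prop := Delta `<=` ht_sat H T.

Definition belief_worlds Gamma V : ht_view At :=
  [set p | p.1 `<=` p.2 /\ forall f, Gamma f -> faeel_sat f V p.1 p.2].

Definition view_le V' V : Prop :=
  (forall H T, V (H, T) -> exists2 H', V' (H', T) & H' `<=` H) /\
  (forall H' T, V' (H', T) -> exists2 H, V (H, T) & H' `<=` H).

Lemma ht_sat_total T (g : oformula At) : ht_sat T T g <-> classical_sat T g.
Proof.
elim: g => [|a|g IHg h IHh|g IHg h IHh|g IHg h IHh] //=;
  rewrite ?orNp IHg IHh //.
by split=> [[sat _]|sat].
Qed.

Lemma ht_model_total Delta T : ht_model Delta T T <-> classical_models Delta T.
Proof. by split=> sat g /sat /ht_sat_total. Qed.

Lemma classical_sat_reduct W T f :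
  classical_sat T (reduct W f) <-> g91_sat W T f.
Proof.
elim: f => [|a|f IHf g IHg|f IHf g IHg|f IHf g IHg|f _] //=;
  rewrite ?IHf ?IHg //.
by case: asboolP => [Wf|nWf]; split=> //= /nWf.
Qed.

Lemma ht_sat_reduct_L W H T f :
  ht_sat H T (reduct W (L f)) <-> g91_believes W f.
Proof. by rewrite /=; case: asboolP => Wf; split=> //= _; split=> //; left. Qed.

Lemma there_total_view W : there_view (total_view W) = W.
Proof. by rewrite /there_view image_comp image_id. Qed.

Lemma faeel_sat_L_total_view W H T f :
  faeel_sat (L f) (total_view W) H T <->
  forall J, W J -> faeel_sat f (total_view W) J J.
Proof.
exact: (image_subP (Y := fun p => faeel_sat f (total_view W) p.1 p.2)).
Qed.

Lemma faeel_sat_total_view W H T f :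
  faeel_sat f (total_view W) H T <-> ht_sat H T (reduct W f).
Proof.
elim: f H T => [|a|f IHf g IHg|f IHf g IHg|f IHf g IHg|f IHf] H T.
- by [].
- by [].
- by rewrite /= IHf IHg.
- by rewrite /= IHf IHg.
- rewrite /= there_total_view !IHf !IHg !ht_sat_total !orNp.
  by split=> -[].
- rewrite ht_sat_reduct_L faeel_sat_L_total_view.
  by split=> Wf J /Wf; rewrite IHf ht_sat_total classical_sat_reduct.
Qed.

Lemma belief_worlds_total_view Gamma W H T :
  belief_worlds Gamma (total_view W) (H, T) <->
  H `<=` T /\ ht_model (subjective_reduct Gamma W) H T.
Proof.
rewrite /ht_model /subjective_reduct image_subP.
by split=> -[HT sat]; split=> // f /sat /faeel_sat_total_view.
Qed.

Lemma belief_modelP Gamma V H T :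
  belief_model Gamma (BeliefInterp V H T) <->
  [/\ V !=set0, V `<=` belief_worlds Gamma V & belief_worlds Gamma V (H, T)].
Proof.
split=> [[[[V0 Vsub] HT] sat]|[V0 Vworlds [HT sat]]].
- split=> // [p Vp|].
  + by split=> [|f Gf]; [exact: Vsub|apply: sat => //; left].
  + by split=> // f Gf; apply: (sat _ Gf (H, T)); right.
- split; first by split=> //; split=> // p /Vworlds[].
  by move=> f Gf p [/Vworlds[_ satp]|->]; [exact: satp|exact: sat].
Qed.

Lemma belief_model_at_world Gamma V H T H' T' :
  belief_model Gamma (BeliefInterp V H T) -> V (H', T') ->
  belief_model Gamma (BeliefInterp V H' T').
Proof.
by move=> /belief_modelP[V0 Vworlds _] /Vworlds VHT'; apply/belief_modelP.
Qed.

Lemma belief_model_total_view Gamma W H T :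
  belief_model Gamma (BeliefInterp (total_view W) H T) <->
  [/\ W !=set0, W `<=` classical_models (subjective_reduct Gamma W),
      H `<=` T & ht_model (subjective_reduct Gamma W) H T].
Proof.
rewrite belief_modelP.
split=> [[/nonempty_image W0 /image_subP Wsat /belief_worlds_total_view[]]|].
- by split=> // J /Wsat /belief_worlds_total_view[_ /ht_model_total].
- move=> [W0 Wsat HT satHT]; split; first exact: image_nonempty.
  + apply/image_subP => J /Wsat satJ; apply/belief_worlds_total_view.
    by split=> //; exact/ht_model_total.
  + exact/belief_worlds_total_view.
Qed.

Lemma bi_lt_same_view V H' H T :
  bi_lt (BeliefInterp V H' T) (BeliefInterp V H T) <-> H' `<` H.
Proof.
rewrite properEneq; split=> [[[_ /= H'H _ _] neq]|[/eqP neq H'H]].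
- by split=> //; apply/eqP => eqH; apply: neq; rewrite eqH.
- split; last by case.
  by split=> //= K S VKS; exists K.
Qed.

Lemma EQB_view_minimal Gamma V V' H T H' T' :
  EQB Gamma (BeliefInterp V H T) -> V (H, T) ->
  belief_model Gamma (BeliefInterp V' H' T') -> view_le V' V -> V' = V.
Proof.
move=> [_ _ minV] VHT modV' [le_ex le_all]; apply: contrapT => neqV.
have [K V'KT KH] := le_ex _ _ VHT; apply: minV.
exists (BeliefInterp V' K T); split.
  exact: belief_model_at_world modV' V'KT.
by split; [split|case].
Qed.

Lemma EQB_total_view_stable Gamma W T :
  EQB Gamma (BeliefInterp (total_view W) T T) ->
  stable_models (subjective_reduct Gamma W) T.
Proof.
move=> [_ /belief_model_total_view[W0 Wsat _ satT] minT].
split=> [|[H [ltHT satH]]]; first exact/ht_model_total.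
apply: minT; exists (BeliefInterp (total_view W) H T).
split; last exact/bi_lt_same_view.
by apply/belief_model_total_view; split=> //; exact: properW.
Qed.

Lemma stable_EQB_total_view Gamma W T0 T :
  EQB Gamma (BeliefInterp (total_view W) T0 T0) -> W T0 ->
  stable_models (subjective_reduct Gamma W) T ->
  EQB Gamma (BeliefInterp (total_view W) T T).
Proof.
move=> eqbT0 WT0 [satT minT].
have [_ /belief_model_total_view[W0 Wsat _ _] _] := eqbT0.
split.
- by split=> // _ [J _ <-].
- by apply/belief_model_total_view; split=> //; exact/ht_model_total.
- case=> -[V H S] [modV ltV]; have [[/= eqST _ le_ex le_all] _] := ltV.
  have eqV : V = total_view W.
    by apply: (EQB_view_minimal eqbT0 _ modV) => //; exists T0.
  move: modV ltV; rewrite eqST eqV.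
  move=> /belief_model_total_view[_ _ _ satH] /bi_lt_same_view ltHT.
  by apply: minT; exists H.
Qed.

End EquilibriumWorldViews.

Theorem theorem3 (At : Type) (Gamma : theory At) (W : set (interp At)) :
  equilibrium_world_view Gamma W -> g91_world_view Gamma W.
Proof.
move=> [[/nonempty_image[T0 WT0] _] defW].
have eqbP T : W T <-> EQB Gamma (BeliefInterp (total_view W) T T).
  by rewrite {1}defW.
have /eqbP eqbT0 := WT0.
apply/seteqP; split=> T; first by move=> /eqbP /EQB_total_view_stable.
by move=> stT; apply/eqbP; exact: stable_EQB_total_view eqbT0 WT0 stT.
Qed.
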